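(* Let $D$ be a finite digraph. (1) If $\mathrm{cl}_D$ has rank $2$, then $\mathrm{cl}_D$ is solvable over all sufficiently large alphabets, i.e. there is an integer $q_0$ such that $\mathrm{cl}_D$ is solvable over every finite set $A$ with $|A|\ge q_0$. (2) If the minimum in-degree of $D$ is equal to the rank of $\mathrm{cl}_D$, then $\mathrm{cl}_D$ is solvable by linear functions over all sufficiently large prime powers, i.e. there is an integer $q_0$ such that $\mathrm{cl}_D$ is solvable by linear functions over $\mathrm{GF}(q)$ for every prime power $q\ge q_0$.
   Context: Digraphs have no repeated arcs but may have loops and arcs in both directions between two vertices. For a vertex $v$ of $D$, $v^-=\{u:(u,v)\in E(D)\}$ is its in-neighbourhood and $|v^-|$ its in-degree. For a digraph $D$ with vertex set $V$, $|V|=n$, and $X\subseteq V$, let $c_D(X)=X\cup\{v\in V:v^-\subseteq X\}$ and $\mathrm{cl}_D(X)=c_D^n(X)$ ($n$-fold iteration); this is a closure operator on $V$. The rank of a closure operator $\mathrm{cl}$ on $V$ is $r=\min\{|b|: b\subseteq V,\ \mathrm{cl}(b)=V\}$. For a finite set $A$ with $|A|\ge2$ and a family $f=(f_v)_{v\in V}$ of partitions of $A^r$, $f_X$ ($X\subseteq V$) denotes the common refinement of the $f_v$, $v\in X$ (parts are the nonempty intersections of parts; $f_\emptyset$ has one part). A coding function for $\mathrm{cl}$ over $A$ is a family $f=(f_v)_{v\in V}$ of partitions of $A^r$, each into at most $|A|$ parts, such that $f_X=f_{\mathrm{cl}(X)}$ for all $X\subseteq V$. $\mathrm{cl}$ is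 solvable over $A$ if it has a coding function $f$ (called a solution) such that $f_V$ is the partition of $A^r$ into singletons. It is solvable by linear functions over $\mathrm{GF}(q)$ if, with $A=\mathrm{GF}(q)$, there is a solution $f$ in which each $f_v$ is the partition of $A^r$ into the nonempty fibres of a linear map $\mathrm{GF}(q)^r\to\mathrm{GF}(q)$. *)

(* Defs.v *)
From mathcomp Require Import all_boot all_order all_algebra.

Set Implicit Arguments.
Unset Strict Implicit.
Unset Printing Implicit Defensive.

Import GRing.Theory.

(* A digraph is a finite type V of vertices with an arbitrary relation E on it;
   E u v means that (u, v) is an arc. *)

Definition in_nbhd (V : finType) (E : rel V) (v : V) : {set V} :=
  [set u | E u v].

(* A minimum is attained, so no d qualifies when V is empty. *)
Definition is_min_in_degree (V : finType) (E : rel V) (d : nat) : Prop :=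
  (exists v : V, #|in_nbhd E v| = d) /\ (forall v : V, d <= #|in_nbhd E v|).

Definition cD (V : finType) (E : rel V) (X : {set V}) : {set V} :=
  X :|: [set v | in_nbhd E v \subset X].

Definition clD (V : finType) (E : rel V) (X : {set V}) : {set V} :=
  iter #|V| (cD E) X.

(* The notions below are meant for closure operators but are defined for any
   map on {set V}.  The rank is the intended minimum as soon as
   cl [set: V] = [set: V], as holds for every extensive cl. *)
Definition rank (V : finType) (cl : {set V} -> {set V}) : nat :=
  #|[arg min_(b < [set: V] | cl b == [set: V]) #|b|]|.

(* f_X; the values of g outside X are irrelevant.  For X = set0 the only part
   is the whole (nonempty) set. *)
Definition common_refinement (V T : finType) (f : V -> {set {set T}})
    (X : {set V}) : {set {set T}} :=
  [set B : {set T} | (B != set0) &&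
     [exists g : {ffun V -> {set T}},
        [forall v in X, g v \in f v] && (B == \bigcap_(v in X) g v)]].

(* A^r is represented by the row vectors 'rV[A]_r, for an arbitrary finite set
   A of symbols, so that it is literally F^r when A is a finite field F. *)
Definition coding_function (V : finType) (cl : {set V} -> {set V})
    (A : finType) (f : V -> {set {set 'rV[A]_(rank cl)}}) : Prop :=
  [/\ forall v, partition (f v) [set: 'rV[A]_(rank cl)],
      forall v, #|f v| <= #|A|
    & forall X, common_refinement f X = common_refinement f (cl X)].

Definition solution (V : finType) (cl : {set V} -> {set V})
    (A : finType) (f : V -> {set {set 'rV[A]_(rank cl)}}) : Prop :=
  coding_function f /\
  common_refinement f [set: V] = [set [set x] | x : 'rV[A]_(rank cl)].

Definition solvable (V : finType) (cl : {set V} -> {set V}) (A : finType)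
    : Prop :=
  exists f : V -> {set {set 'rV[A]_(rank cl)}}, solution f.

(* F^o is F regarded as a vector space over itself. *)
Definition linearly_solvable (V : finType) (cl : {set V} -> {set V})
    (F : finFieldType) : Prop :=
  exists2 f : V -> {set {set 'rV[F]_(rank cl)}}, solution f &
    forall v : V, exists phi : {linear 'rV[F]_(rank cl) -> F^o},
      f v = preim_partition phi [set: 'rV[F]_(rank cl)].

(* Main.v *)
(** Part (2): if all in-degrees are at least the rank r, evaluate a polynomial
    of degree < r, coded by its coefficients, at distinct points of the field;
    any r values determine it, so each vertex is determined by its in-neighbours.

    Part (1): the partitions of A^2 given by x, y and x + y (for any group law
    on A) suffice.  Outside cl(empty), the maximal flats cl{u} are pairwise
    disjoint, and giving all vertices of a flat the same colour satisfies every
    vertex but the chosen generator (root) of the flat.  Each root either has an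
    in-neighbour in its own flat or in-neighbours in two distinct flats.  There
    are two roots a, b with cl{a, b} = V; the other roots can then be coloured by
    x, y, x + y one by one, in the order in which {a, b} generates them. *)
Require Import Defs.
From mathcomp Require Import all_boot all_order all_algebra.

Set Implicit Arguments.
Unset Strict Implicit.
Unset Printing Implicit Defensive.

Import GRing.Theory.

(** * Partitions into fibres of maps, and their common refinements *)

Section Kernels.

Variables (V T C : finType) (phi : V -> T -> C).

Definition agree (X : {set V}) : rel T :=
  [rel x y | [forall v in X, phi v x == phi v y]].

Lemma agreeP (X : {set V}) x y :
  reflect (forall v, v \in X -> phi v x = phi v y) (agree X x y).
Proof. by apply: (iffP forall_inP) => H v /H /eqP. Qed.

Let part v : {set {set T}} := preim_partition (phi v) [set: T].

Lemma mem_preim_partition v (B : {set T}) :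
  reflect (exists x, B = [set y | phi v x == phi v y]) (B \in part v).
Proof.
apply: (iffP imsetP) => [[x _ ->]|[x ->]]; exists x => //;
  by apply/setP=> y; rewrite !inE.
Qed.

(** Chosen parts with a common point [x] must be the fibres through [x], so refining these
    partitions amounts to intersecting kernels. *)
Lemma common_refinement_kernel (X : {set V}) :
  common_refinement part X = [set [set y | agree X x y] | x : T].
Proof.
apply/setP=> B; rewrite inE; apply/andP/imsetP => [[/set0Pn[x xB]]|[x _ ->]].
  case/existsP=> g /andP[/forall_inP gP /eqP defB]; exists x => //.
  move: xB; rewrite {}defB => /bigcapP xg.
  apply/setP=> y; rewrite inE; apply/bigcapP/agreeP => yg v vX.
    have /mem_preim_partition[z gz] := gP v vX.
    by move: (xg v vX) (yg v vX); rewrite gz !inE => /eqP <- /eqP.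
  have /mem_preim_partition[z gz] := gP v vX.
  by move: (xg v vX); rewrite gz !inE (yg v vX).
split; first by apply/set0Pn; exists x; rewrite inE; apply/agreeP.
apply/existsP; exists [ffun v => [set y | phi v x == phi v y]].
apply/andP; split.
  by apply/forall_inP => v vX; rewrite ffunE; apply/mem_preim_partition; exists x.
apply/eqP/setP=> y; rewrite inE; apply/agreeP/bigcapP => H v vX.
  by rewrite ffunE inE H.
by have := H v vX; rewrite ffunE inE => /eqP.
Qed.

Lemma card_preim_partition v : #|part v| <= #|C|.
Proof.
have sub : part v \subset [set [set y | c == phi v y] | c : C].
  by apply/subsetP=> B /mem_preim_partition[x ->]; apply/imsetP; exists (phi v x).
exact: leq_trans (subset_leq_card sub) (leq_imset_card _ _).
Qed.

End Kernels.

(** * Closure, rank, and a local criterion for solutions *)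

Section Closure.

Variables (V : finType) (E : rel V).
Implicit Types (X Y : {set V}) (u v w : V).

Local Notation cl := (clD E).
Local Notation nb := (in_nbhd E).

Lemma cD_ext X : X \subset cD E X.
Proof. exact: subsetUl. Qed.

Lemma cDP X v : reflect (v \in X \/ nb v \subset X) (v \in cD E X).
Proof. by rewrite in_setU [v \in [set _ | _]]inE; exact: orP. Qed.

(** Every step that is not yet stationary adds a vertex, so [#|V|] iterations reach a fixed
    point. *)
Lemma iter_cD_card X k :
  cD E (iter k (cD E) X) = iter k (cD E) X \/ k <= #|iter k (cD E) X|.
Proof.
elim: k => [|k IH]; first by right.
case: IH => [fx|le]; first by left; rewrite iterS !fx.
have [fx|ne] := eqVneq (cD E (iter k (cD E) X)) (iter k (cD E) X).
  by left; rewrite iterS !fx.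
right; apply: leq_ltn_trans le _; rewrite iterS; apply: proper_card.
by rewrite properEneq eq_sym ne cD_ext.
Qed.

Lemma clD_fixed X : cD E (cl X) = cl X.
Proof.
case: (iter_cD_card X #|V|) => // le.
have -> : cl X = setT.
  by apply/eqP; rewrite eqEcard subsetT cardsT.
by apply/eqP; rewrite eqEsubset subsetT cD_ext.
Qed.

Lemma iter_cD_ext X k : X \subset iter k (cD E) X.
Proof. by elim: k => // k IH; apply: subset_trans IH (cD_ext _). Qed.

Lemma clD_ext X : X \subset cl X.
Proof. exact: iter_cD_ext. Qed.

Lemma mem_clD X v : nb v \subset cl X -> v \in cl X.
Proof. by move=> sub; rewrite -clD_fixed; apply/cDP; right. Qed.

Lemma clD_min X Y :
  X \subset Y -> (forall v, nb v \subset Y -> v \in Y) -> cl X \subset Y.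
Proof.
move=> XY closedY; rewrite /clD; elim: #|V| => // k IH.
apply/subsetP=> v /cDP[/(subsetP IH) //|sub].
exact/closedY/(subset_trans sub IH).
Qed.

Lemma clD_sub X Y : X \subset cl Y -> cl X \subset cl Y.
Proof. by move=> XY; apply: clD_min => // v /mem_clD. Qed.

Lemma clD_nbhd X v : v \in cl X -> v \notin X -> nb v \subset cl X.
Proof.
rewrite /clD; elim: #|V| => [|k IH]; first by move=> ->.
move=> /cDP[vk|sub] vX; last exact: subset_trans sub (cD_ext _).
exact: subset_trans (IH vk vX) (cD_ext _).
Qed.

(** The height is the first stage at which a vertex appears: outside [X], a vertex enters only after
    all its in-neighbours. *)
Lemma clD_height X :
  cl X = setT -> exists h : V -> nat,
    forall v w, v \notin X -> w \in nb v -> h w < h v.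
Proof.
move=> clX; pose st k := iter k (cD E) X.
have ex v : exists k, v \in st k.
  by exists #|V|; have := in_setT v; rewrite -clX.
exists (fun v => ex_minn (ex v)) => v w vX wv.
case: ex_minnP => j _ jmin; case: ex_minnP => [[|k]] vk kmin.
  by rewrite vk in vX.
rewrite ltnS; apply: jmin; case/cDP: vk => [/kmin|/subsetP->//].
by rewrite ltnn.
Qed.

Lemma rank_le X : cl X = setT -> rank cl <= #|X|.
Proof.
move=> clX; rewrite /rank; case: arg_minnP => [|b _ bmin].
  by apply/eqP; apply/eqP; rewrite eqEsubset subsetT clD_ext.
by apply: bmin; apply/eqP.
Qed.

Lemma rank_basis : exists2 X, cl X = setT & #|X| = rank cl.
Proof.
rewrite /rank; case: arg_minnP => [|b /eqP clb _]; last by exists b.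
by rewrite eqEsubset subsetT clD_ext.
Qed.

(** The vertices whose maps agree at [x] and [y] form a closed set, so it suffices to compare each
    vertex with its in-neighbours. Values may lie in any [C] no larger than [A], for instance in a
    group. *)
Lemma kernel_solution (A C : finType) (phi : V -> 'rV[A]_(rank cl) -> C) :
  #|C| <= #|A| ->
  (forall v x y, (forall u, u \in nb v -> phi u x = phi u y) ->
     phi v x = phi v y) ->
  (forall x y, (forall v, phi v x = phi v y) -> x = y) ->
  @solution V cl A (fun v => preim_partition (phi v) [set: 'rV[A]_(rank cl)]).
Proof.
move=> leCA local inj; split; first split.
- by move=> v; apply: preim_partitionP.
- by move=> v; apply: leq_trans (card_preim_partition _ _) leCA.
- move=> X; rewrite !common_refinement_kernel; apply: eq_imset => x.
  apply/setP=> y; rewrite !inE; apply/agreeP/agreeP => H v vX; last first.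
    by apply: H; apply: (subsetP (clD_ext X)).
  suff /subsetP/(_ v vX) : cl X \subset [set v | phi v x == phi v y].
    by rewrite inE => /eqP.
  apply: clD_min => [|w /subsetP sub]; first by apply/subsetP=> w /H; rewrite inE => ->.
  by rewrite inE; apply/eqP/local => u /sub; rewrite inE => /eqP.
- rewrite common_refinement_kernel; apply: eq_imset => x.
  apply/setP=> y; rewrite !inE; apply/agreeP/eqP => [H|-> //].
  by apply/esym/inj => v; apply: H.
Qed.

Lemma polynomial_solution (F : finFieldType) :
  is_min_in_degree E (rank cl) -> #|V| <= #|F| -> linearly_solvable cl F.
Proof.
case=> [[v0 _] degE] leVF.
pose alpha (v : V) : F := enum_val (widen_ord leVF (enum_rank v)).
have alpha_inj : injective alpha.
  by move=> u v /enum_val_inj/(congr1 val)/= e; apply/enum_rank_inj/val_inj.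
pose phi v : {linear 'rV[F]_(rank cl) -> F^o} :=
  (horner_eval (alpha v) : {linear {poly F} -> F^o}) \o @rVpoly F (rank cl).
exists (fun v => preim_partition (phi v) setT); last by move=> v; exists (phi v).
have inj v x y : (forall u, u \in nb v -> phi u x = phi u y) -> x = y.
  move=> eqxy; apply/eqP; rewrite -subr_eq0; apply/eqP.
  apply: (can_inj (@rVpolyK _ _)); rewrite linear0; apply/eqP.
  apply: contraT => nz.
  (* A nonzero polynomial with [rank cl] coefficients has fewer than [rank cl] roots, against the
     in-degree bound. *)
  have := max_poly_roots (rs := [seq alpha u | u <- enum (nb v)]) nz.
  rewrite size_map -cardE map_inj_uniq // enum_uniq => /(_ _ isT) bound.
  have /bound/leq_trans/(_ (size_poly _ _)) :
    all (root (rVpoly (x - y))) [seq alpha u | u <- enum (nb v)].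
    apply/allP=> _ /mapP[u + ->]; rewrite mem_enum => /eqxy e.
    have : (phi u (x - y) = 0)%R by rewrite linearB e subrr.
    by move/eqP.
  by rewrite ltnNge degE.
apply: kernel_solution => // [v x y /inj -> //|x y H].
by apply: (inj v0).
Qed.

End Closure.

(* The colours of the pair P determine the colour of v, if any two of the three
   colours determine the third. *)
Definition rainbow_or_matching (T K : eqType) (chi : T -> K) (P : T * T) (v : T) :=
  (chi P.1 != chi P.2) || (chi P.1 == chi v).

Lemma avoid_two (i j : 'I_3) : exists c, (c != i) && (c != j).
Proof.
apply/existsP; rewrite -[[exists _, _]]negbK negb_exists.
apply/negP => /forallP H.
have /subset_leq_card : [set: 'I_3] \subset [set i; j].
  by apply/subsetP=> c _; have := H c; rewrite !inE negb_and !negbK.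
by rewrite cardsT card_ord cards2; case: (_ != _).
Qed.

(* Induction on s, removing the last vertex v: a requirement Pa or Pb involving v
   is replaced by the in-neighbours N v of v.  If these get distinct colours then
   v is free to avoid the colours of its partners in Pa and Pb; otherwise they
   match the required colour, and so does v. *)
Lemma three_coloring (T : finType) (h : T -> nat) (N : T -> T * T) (a b : T)
    (s : {set T}) (Pa Pb : T * T) :
  a != b -> a \notin s -> b \notin s ->
  (forall v, v \in s -> (N v).1 != (N v).2) ->
  (forall v, v \in s -> forall x, x \in [:: (N v).1; (N v).2] ->
     (x \in a |: (b |: s)) && (h x < h v)) ->
  (Pa.1 != Pa.2) || (Pa.1 == a) ->
  (Pb.1 != Pb.2) || (Pb.1 == b) ->
  {subset [:: Pa.1; Pa.2; Pb.1; Pb.2] <= a |: (b |: s)} ->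
  exists chi : T -> 'I_3,
    [/\ chi a != chi b, forall v, v \in s -> rainbow_or_matching chi (N v) v,
        rainbow_or_matching chi Pa a & rainbow_or_matching chi Pb b].
Proof.
move=> ab; move: {2}#|s| (erefl #|s|) => n.
elim: n s Pa Pb => [|n IH] s Pa Pb cs as_ bs Nne Nin Pane Pbne Pin.
  have s0 : s = set0 by apply/eqP; rewrite -cards_eq0 cs.
  have [i3 [j3 ij3]] : exists i j : 'I_3, i != j by exists ord0, ord_max.
  have Pab x : x \in [:: Pa.1; Pa.2; Pb.1; Pb.2] -> x = a \/ x = b.
    by move=> /Pin; rewrite s0 !inE orbF => /orP[] /eqP; [left|right].
  pose chi x := if x == a then i3 else j3.
  have chi_eq x y : x = a \/ x = b -> y = a \/ y = b -> (chi x == chi y) = (x == y).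
    rewrite /chi => -[] -> [] ->; rewrite ?eqxx ?[b == a]eq_sym ?(negPf ab) ?eqxx //;
      by rewrite ?[j3 == i3]eq_sym (negPf ij3).
  have [P1 P2] : (Pa.1 = a \/ Pa.1 = b) /\ (Pa.2 = a \/ Pa.2 = b).
    by split; apply: Pab; rewrite !inE eqxx ?orbT.
  have [Q1 Q2] : (Pb.1 = a \/ Pb.1 = b) /\ (Pb.2 = a \/ Pb.2 = b).
    by split; apply: Pab; rewrite !inE eqxx ?orbT.
  exists chi; rewrite /rainbow_or_matching !chi_eq //; try by [left|right].
  by split=> // v; rewrite s0 inE.
have [v0 v0s] : exists v, v \in s by apply/card_gt0P; rewrite cs.
(* Being highest in [s], [v] occurs in no pair [N w] with [w] in [s], so these constraints survive
   its removal. *)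
pose v := [arg max_(v > v0 in s) h v].
have [vs vmax] : v \in s /\ forall w, w \in s -> h w <= h v.
  by rewrite /v; case: arg_maxnP.
have av : a != v by apply: contraNneq as_ => ->.
have bv : b != v by apply: contraNneq bs => ->.
have mem_s' x : x \in a |: (b |: s) -> x != v -> x \in a |: (b |: s :\ v).
  by rewrite !inE => /or3P[] -> // ->; rewrite ?orbT.
have Ns' w : w \in s -> forall x, x \in [:: (N w).1; (N w).2] ->
    (x \in a |: (b |: s :\ v)) && (h x < h w).
  move=> ws x /(Nin w ws)/andP[xin hx]; rewrite hx andbT mem_s' //.
  by apply: contraTneq hx => ->; rewrite -leqNgt vmax.
pose red (P : T * T) := if (P.1 == v) || (P.2 == v) then N v else P.
(* The partner of [v] in a pair containing [v]; for other pairs the value is irrelevant. *)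
pose other (P : T * T) := if P.1 == v then P.2 else P.1.
have red_ne (P : T * T) c : (P.1 != P.2) || (P.1 == c) ->
    ((red P).1 != (red P).2) || ((red P).1 == c).
  by rewrite /red; case: ifP => // _ _; rewrite Nne.
have red_in (P : T * T) : P.1 \in a |: (b |: s) -> P.2 \in a |: (b |: s) ->
    {subset [:: (red P).1; (red P).2] <= a |: (b |: s :\ v)}.
  rewrite /red; case: ifPn => [_ _ _ x /(Ns' v vs)/andP[] //|].
  by rewrite negb_or => /andP[n1 n2] i1 i2 x; rewrite in_cons mem_seq1 => /orP[] /eqP ->;
    apply: mem_s'.
have [||||||||chi [chiab chiN chia chib]] := IH (s :\ v) (red Pa) (red Pb).
- by apply/eqP; rewrite -eqSS -cs (cardsD1 v s) vs.
- by rewrite inE (negPf as_) andbF.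
- by rewrite inE (negPf bs) andbF.
- by move=> w /setD1P[_ /Nne].
- by move=> w /setD1P[_ /Ns'].
- exact: red_ne.
- exact: red_ne.
- move=> x; rewrite (_ : [:: _; _; _; _] =
      [:: (red Pa).1; (red Pa).2] ++ [:: (red Pb).1; (red Pb).2]) // mem_cat.
  by case/orP; apply: red_in; apply: Pin; rewrite !inE eqxx ?orbT.
have [c cP] : exists c,
    if chi (N v).1 == chi (N v).2 then c == chi (N v).1
    else (c != chi (other Pa)) && (c != chi (other Pb)).
  case: (_ == chi (N v).2); last exact: avoid_two.
  by exists (chi (N v).1).
pose chi' x := if x == v then c else chi x.
have chi'E x : x != v -> chi' x = chi x by rewrite /chi' => /negPf ->.
have chi'v : chi' v = c by rewrite /chi' eqxx.
have N_ne w x : w \in s -> x \in [:: (N w).1; (N w).2] -> x != v.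
  move=> ws /(Nin w ws)/andP[_]; apply: contraTneq => ->.
  by rewrite -leqNgt vmax.
have N1 w : w \in s -> chi' (N w).1 = chi (N w).1.
  by move=> ws; rewrite chi'E // (N_ne w) // !inE eqxx.
have N2 w : w \in s -> chi' (N w).2 = chi (N w).2.
  by move=> ws; rewrite chi'E // (N_ne w) // !inE eqxx orbT.
have lift (P : T * T) r : r != v -> (P.1 != P.2) || (P.1 == r) ->
    rainbow_or_matching chi (red P) r ->
    (chi (N v).1 != chi (N v).2 -> c != chi (other P)) ->
    rainbow_or_matching chi' P r.
  move=> rv Pne; rewrite /rainbow_or_matching (chi'E r rv) /red.
  case: ifPn => [Pv|]; last first.
    by rewrite negb_or => /andP[n1 n2]; rewrite !chi'E.
  move=> good oth.
  (* If [N v] is monochromatic, the reduced requirement forces its colour, which is [c], to be that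
     of [r]; otherwise [c] avoids the partner. *)
  have {good}oth : (c != chi (other P)) || (c == chi r).
    move: cP; case: eqP good oth => [_ /= /eqP -> _ /eqP ->|_ _ ->] //.
    by rewrite eqxx orbT.
  move: oth; rewrite /other; case/orP: Pv => [/eqP|] Pv.
    have P2 : P.2 != v.
      by move: Pne; rewrite Pv [v == r]eq_sym (negPf rv) orbF eq_sym.
    by rewrite Pv eqxx chi'v chi'E.
  have P1 : P.1 != v.
    by move: Pne; rewrite (eqP Pv); case: eqP => // -> /=; rewrite eq_sym (negPf rv).
  rewrite (negPf P1) (eqP Pv) chi'v chi'E // eq_sym.
  by case: eqP => //= ->.
exists chi'; split.
- by rewrite !chi'E.
- move=> w ws; rewrite /rainbow_or_matching N1 // N2 //.
  have [->|wv] := eqVneq w v.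
    by rewrite chi'v; move: cP; case: eqP => //= _ /eqP ->.
  by rewrite chi'E //; apply: chiN; rewrite !inE wv.
- by apply: lift => //; move: cP; case: ifP => // _ /andP[].
- by apply: lift => //; move: cP; case: ifP => // _ /andP[].
Qed.

(** * Flats generated by one vertex, and the colouring in rank 2 *)

Section Flats.

Variables (V : finType) (E : rel V).
Implicit Types (u v w : V).

Local Notation cl := (clD E).
Local Notation nb := (in_nbhd E).

Lemma mem_flat u : u \in cl [set u].
Proof. by rewrite -sub1set clD_ext. Qed.

Lemma flat_sub u w : u \in cl [set w] -> cl [set u] \subset cl [set w].
Proof. by move=> uw; apply: clD_sub; rewrite sub1set. Qed.

(* If neither of u, w lay in the flat of the other, the part of cl [set u]
   outside cl [set w] would be closed up to cl set0: no vertex of the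
   intersection could be the first one to be reached from u. *)
Lemma flats_nested u w v :
  v \notin cl set0 -> v \in cl [set u] -> v \in cl [set w] ->
  (u \in cl [set w]) || (w \in cl [set u]).
Proof.
move=> v0 vu vw; apply: contraT; rewrite negb_or => /andP[uw wu].
have /subsetP/(_ v vu) :
    cl [set u] \subset cl [set u] :&: (~: cl [set w] :|: cl set0).
  apply: clD_min => [|t tsub]; first by rewrite sub1set !inE mem_flat uw.
  have tu : t \in cl [set u].
    exact: mem_clD (subset_trans tsub (subsetIl _ _)).
  rewrite !inE tu; case tw: (t \in cl [set w]) => //=.
  apply: mem_clD; apply/subsetP=> z zt.
  have := subsetP tsub z zt; rewrite !inE => /andP[_] /orP[|//].
  rewrite (subsetP (clD_nbhd tw _) z zt) //.
  by apply: contraNN wu; rewrite inE => /eqP <-.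
by rewrite !inE vw (negPf v0) andbF.
Qed.

(** Maximality of [cl [set u]] under inclusion, expressed through generators: [u \in cl [set w]]
    means that the flat of [w] contains that of [u]. *)
Definition maximal_flat u := [forall w, (u \in cl [set w]) ==> (w \in cl [set u])].

Lemma maximal_flat_exists v : exists u, maximal_flat u && (v \in cl [set u]).
Proof.
have vv := mem_flat v.
exists [arg max_(u > v | v \in cl [set u]) #|cl [set u]|].
case: arg_maxnP => // u vu umax; rewrite vu andbT.
apply/forallP=> w; apply/implyP=> uw.
have sub := flat_sub uw.
have /eqP -> : cl [set u] == cl [set w].
  by rewrite eqEcard sub; apply: umax; apply: subsetP vu.
exact: mem_flat.
Qed.

(** The choice by [pick] depends only on the set of candidates, so all vertices of a maximal flat
    outside [cl set0] get the same root. The default is never reached. *)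
Definition root_of v := odflt v [pick u | maximal_flat u && (v \in cl [set u])].

Lemma root_ofP v : maximal_flat (root_of v) /\ v \in cl [set root_of v].
Proof.
rewrite /root_of; case: pickP => [u /andP[]//|no].
by have [u] := maximal_flat_exists v; rewrite no.
Qed.

(** Maximal flats meeting outside [cl set0] coincide, so [pick] searches the same candidates for [u]
    and [v]. *)
Lemma root_of_eq u v :
  v \notin cl set0 -> v \in cl [set u] -> maximal_flat u -> root_of v = root_of u.
Proof.
move=> v0 vu umax; rewrite /root_of.
have eqp z : maximal_flat z && (v \in cl [set z]) = maximal_flat z && (u \in cl [set z]).
  apply: andb_id2l => zmax; apply/idP/idP => [vz|/flat_sub/subsetP/(_ v vu)//].
  by case/orP: (flats_nested v0 vu vz) => // /(implyP (forallP zmax u)).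
rewrite (eq_pick eqp); case: pickP => // no.
by have [z] := maximal_flat_exists u; rewrite no.
Qed.

Lemma root_of_idem v : v \notin cl set0 -> root_of (root_of v) = root_of v.
Proof. by have [m vr] := root_ofP v => v0; rewrite -(root_of_eq v0 vr m). Qed.

Lemma root_of_notin v : v \notin cl set0 -> root_of v \notin cl set0.
Proof.
apply: contraNN => r0; have [_] := root_ofP v.
by apply: subsetP; apply: clD_sub; rewrite sub1set.
Qed.

Lemma nbhd_notin v : v \notin cl set0 -> exists w, w \in nb v :\: cl set0.
Proof.
move=> v0; apply/set0Pn; apply: contraNneq v0 => /eqP.
by rewrite setD_eq0; apply: mem_clD.
Qed.

Lemma nonroot_nbhd v : v \notin cl set0 -> root_of v != v ->
  forall w, w \in nb v :\: cl set0 -> root_of w = root_of v.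
Proof.
move=> v0 rv w /setDP[wv w0]; have [m vr] := root_ofP v.
have /subsetP sub : nb v \subset cl [set root_of v].
  by apply: clD_nbhd => //; rewrite inE eq_sym.
by rewrite (root_of_eq w0 (sub w wv) m) root_of_idem.
Qed.

(** If all in-neighbours outside [cl set0] share one root, they lie in its flat, hence so does [v],
    and that root is [v] itself. *)
Lemma root_nbhd v : v \notin cl set0 -> root_of v = v ->
  exists P : V * V, [&& P.1 \in nb v :\: cl set0, P.2 \in nb v :\: cl set0 &
    (root_of P.1 != root_of P.2) || (root_of P.1 == v)].
Proof.
move=> v0 rv; have [w wv] := nbhd_notin v0.
case: (boolP [forall w' in nb v :\: cl set0, root_of w' == root_of w]) => [/forall_inP same|].
  exists (w, w); rewrite /= wv eqxx /= -rv; apply/eqP.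
  have /setDP[_ w0] := wv; have [m _] := root_ofP w.
  rewrite -[LHS]root_of_idem //; apply/esym/root_of_eq => //.
  apply: mem_clD; apply/subsetP=> z zv.
  case z0: (z \in cl set0); first by apply: subsetP z0; apply: clD_sub; rewrite sub0set.
  have /same/eqP <- : z \in nb v :\: cl set0 by rewrite in_setD z0.
  by have [] := root_ofP z.
rewrite negb_forall_in => /exists_inP[w' w'v ne].
by exists (w', w); rewrite /= w'v wv ne.
Qed.

(** From a non-root, any in-neighbour outside [cl set0] is lower and has the same root; descend
    until the root is met. *)
Lemma root_of_height a b (h : V -> nat) :
  (forall v w, v \notin [set a; b] -> w \in nb v -> h w < h v) ->
  root_of a = a -> root_of b = b ->
  forall v, v \notin cl set0 -> h (root_of v) <= h v.
Proof.
move=> hP ra rb v; have [n] := ubnP (h v); elim: n v => // n IH v hv v0.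
have [-> //|rv] := eqVneq (root_of v) v.
have vab : v \notin [set a; b].
  by apply: contraNN rv; rewrite !inE => /orP[] /eqP ->; rewrite ?ra ?rb.
have [w wv] := nbhd_notin v0; have /setDP[wn w0] := wv.
have hw := hP v w vab wn; rewrite -(nonroot_nbhd v0 rv wv).
apply: leq_trans (IH w _ w0) (ltnW hw).
exact: leq_trans hw _.
Qed.

(** Replace both elements of a basis by their roots. Equal roots, or a basis element in [cl set0],
    would leave one vertex generating everything. *)
Lemma rank2_root_basis : rank cl = 2 ->
  exists a b, [/\ a != b, root_of a = a, root_of b = b &
    [/\ a \notin cl set0, b \notin cl set0 & cl [set a; b] = setT]].
Proof.
move=> rk2; have [X clX] := rank_basis E; rewrite rk2 => /eqP/cards2P[a [b [ab defX]]].
have no1 (Y : {set V}) : cl Y = setT -> 1 < #|Y| by rewrite -rk2; apply: rank_le.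
have spans (Y : {set V}) : a \in cl Y -> b \in cl Y -> cl Y = setT.
  move=> aY bY; apply/eqP; rewrite eqEsubset subsetT -clX; apply: clD_sub.
  by rewrite defX subUset !sub1set aY.
have sub0 (Y : {set V}) v : v \in cl set0 -> v \in cl Y.
  by apply: subsetP; apply: clD_sub; rewrite sub0set.
have a0 : a \notin cl set0.
  apply: contraT; rewrite negbK => /(sub0 [set b]) /spans/(_ (mem_flat b))/no1.
  by rewrite cards1.
have b0 : b \notin cl set0.
  apply: contraT; rewrite negbK => /(sub0 [set a]) /(spans _ (mem_flat a))/no1.
  by rewrite cards1.
have [[_ ar] [_ br]] := (root_ofP a, root_ofP b).
exists (root_of a), (root_of b).
split; rewrite ?root_of_idem ?root_of_notin //.
  apply/eqP=> e; have /no1 : cl [set root_of a] = setT by apply: spans => //; rewrite e.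
  by rewrite cards1.
split=> //; apply: spans.
  by apply: subsetP ar; apply: clD_sub; rewrite sub1set (subsetP (clD_ext _ _)) // !inE eqxx.
by apply: subsetP br; apply: clD_sub; rewrite sub1set (subsetP (clD_ext _ _)) // !inE eqxx orbT.
Qed.

(** [three_coloring] is applied to the roots, each in-neighbour being replaced by its root; every
    other vertex takes the colour of its root. *)
Lemma rank2_coloring : rank cl = 2 ->
  exists chi : V -> 'I_3,
    (exists a b, [/\ a \notin cl set0, b \notin cl set0 & chi a != chi b]) /\
    forall v, v \notin cl set0 ->
      exists P : V * V, [&& P.1 \in nb v :\: cl set0, P.2 \in nb v :\: cl set0 &
        rainbow_or_matching chi P v].
Proof.
move=> /rank2_root_basis[a [b [ab ra rb [a0 b0 clab]]]].
have [h hP] := clD_height clab.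
have hr := root_of_height hP ra rb.
pose Q v (P : V * V) := [&& P.1 \in nb v :\: cl set0, P.2 \in nb v :\: cl set0 &
    (root_of P.1 != root_of P.2) || (root_of P.1 == v)].
pose W v := odflt (v, v) [pick P | Q v P].
have WP v : v \notin cl set0 -> root_of v = v -> Q v (W v).
  move=> v0 rv; rewrite /W; case: pickP => // no.
  by have [P] := root_nbhd v0 rv; rewrite [X in is_true X]no.
pose N v := (root_of (W v).1, root_of (W v).2).
pose roots := [set v | (v \notin cl set0) && (root_of v == v)].
pose s := roots :\ a :\ b.
have in_s x : x \notin cl set0 -> root_of x \in a |: (b |: s).
  move=> x0; rewrite !inE root_of_idem // root_of_notin // eqxx andbT /=.
  by case: eqP => //= _; case: eqP.
have Nin v : v \notin cl set0 -> root_of v = v ->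
    {subset [:: (N v).1; (N v).2] <= a |: (b |: s)}.
  move=> v0 rv x; have /and3P[/setDP[_ w1] /setDP[_ w2] _] := WP v v0 rv.
  by rewrite in_cons mem_seq1 => /orP[] /eqP ->; apply: in_s.
have Nh v : v \in s -> forall x, x \in [:: (N v).1; (N v).2] -> h x < h v.
  rewrite !inE => /and4P[vb va v0 /eqP rv] x.
  have /and3P[/setDP[n1 w1] /setDP[n2 w2] _] := WP v v0 rv.
  have vab : v \notin [set a; b] by rewrite !inE negb_or va vb.
  by rewrite in_cons mem_seq1 => /orP[] /eqP ->;
    apply: leq_ltn_trans (hr _ _) (hP _ _ _ _).
have Nne v : v \notin cl set0 -> root_of v = v -> ((N v).1 != (N v).2) || ((N v).1 == v).
  by move=> v0 rv; have /and3P[] := WP v v0 rv.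
have [|||||||chi [chiab chis chia chib]] :=
    @three_coloring V h N a b s (N a) (N b) ab.
- by rewrite !inE eqxx andbF.
- by rewrite !inE eqxx.
- move=> v vs; move: (vs); rewrite !inE => /and4P[_ _ v0 /eqP rv].
  (* The roots in [N v] are strictly lower than [v], so neither is [v] and the two must differ. *)
  case/orP: (Nne v v0 rv) => // /eqP e.
  by have := Nh v vs (N v).1; rewrite inE eqxx e ltnn => /(_ isT).
- move=> v vs x xN; rewrite Nh // andbT.
  by move: vs; rewrite !inE => /and4P[_ _ v0 /eqP rv]; have := Nin v v0 rv x xN; rewrite !inE.
- exact: Nne.
- exact: Nne.
- move=> x; rewrite (_ : [:: _; _; _; _] =
      [:: (N a).1; (N a).2] ++ [:: (N b).1; (N b).2]) // mem_cat.
  by case/orP; apply: Nin.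
exists (chi \o root_of); split; first by exists a, b; rewrite /= ra rb.
move=> v v0; have [rv|rv] := eqVneq (root_of v) v; last first.
  have [w wv] := nbhd_notin v0; exists (w, w).
  by rewrite /rainbow_or_matching /= wv (nonroot_nbhd v0 rv wv) eqxx orbT.
have /and3P[W1 W2 _] := WP v v0 rv; exists (W v); rewrite W1 W2 /=.
have : rainbow_or_matching chi (N v) v.
  have := in_s v v0; rewrite rv in_setU1 => /orP[/eqP -> //|].
  by rewrite in_setU1 => /orP[/eqP -> //|/chis].
by rewrite /rainbow_or_matching /= rv.
Qed.

End Flats.

(** * Coding in rank 2 by the parity-check code of length three *)

Definition ternary_code (Z : zmodType) (i : 'I_3) (x y : Z) : Z :=
  nth 0%R [:: x; y; (x + y)%R] i.

Lemma ternary_code_inj (Z : zmodType) (i j : 'I_3) (x y x' y' : Z) :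
  i != j -> ternary_code i x y = ternary_code i x' y' ->
  ternary_code j x y = ternary_code j x' y' -> x = x' /\ y = y'.
Proof.
case: i j => [[|[|[]]] //= ?] [[|[|[]]] //= ?] _; rewrite /ternary_code /= => e1 e2;
  first [ by [] | by move: e2; rewrite e1 => /addrI | by move: e2; rewrite e1 => /addIr
        | by move: e1; rewrite e2 => /addrI | by move: e1; rewrite e2 => /addIr ].
Qed.

Lemma rank2_solvable (V : finType) (E : rel V) (A : finType) :
  rank (clD E) = 2 -> 0 < #|A| -> solvable (clD E) A.
Proof.
move=> rk2 A0; have [chi [[a [b [a0 b0 chiab]]] chiP]] := rank2_coloring rk2.
(* Addition modulo [n.+1] on ['I_n.+1] supplies the group law for an alphabet of any positive
   size. *)
have [n cardA] : exists n, #|A| = n.+1 by exists #|A|.-1; rewrite prednK.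
pose g (x : A) : 'I_n.+1 := cast_ord cardA (enum_rank x).
have g_inj : injective g by move=> x y /cast_ord_inj/enum_rank_inj.
pose e : 'I_2 -> 'I_(rank (clD E)) := cast_ord (esym rk2).
pose co (i : 'I_2) (x : 'rV[A]_(rank (clD E))) := g (x ord0 (e i)).
(* Vertices of [cl set0] must be constant, since the empty set already determines them. *)
pose phi v x := if v \in clD E set0 then 0%R
  else ternary_code (chi v) (co ord0 x) (co ord_max x).
have inj u v x y : u \notin clD E set0 -> v \notin clD E set0 -> chi u != chi v ->
    phi u x = phi u y -> phi v x = phi v y -> x = y.
  rewrite /phi => /negPf -> /negPf -> ne eu ev.
  have [/g_inj e0 /g_inj e1] := ternary_code_inj ne eu ev.
  apply/rowP=> k; have -> : k = e (cast_ord rk2 k) by rewrite /e cast_ordK.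
  by case: (cast_ord rk2 k) => [[|[|[]]] //= lt];
    [move: e0 | move: e1]; congr (x _ (e _) = y _ (e _)); apply: val_inj.
exists (fun v => preim_partition (phi v) setT); apply: kernel_solution.
- by rewrite cardA card_ord.
- move=> v x y eqn; case v0: (v \in clD E set0); first by rewrite /phi v0.
  have [P /and3P[/setDP[P1 n1] /setDP[P2 n2]]] := chiP v (negbT v0).
  case/orP=> [ne|/eqP e1]; first by rewrite (inj _ _ x y n1 n2 ne) ?eqn.
  by have := eqn _ P1; rewrite /phi v0 (negPf n1) e1.
- by move=> x y eqn; apply: (inj a b).
Qed.

Theorem theorem3 (V : finType) (E : rel V) :
  (rank (clD E) = 2 ->
   exists q0 : nat, forall A : finType, q0 <= #|A| -> solvable (clD E) A)
  /\
  (is_min_in_degree E (rank (clD E)) ->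
   exists q0 : nat, forall F : finFieldType, q0 <= #|F| ->
     linearly_solvable (clD E) F).
Proof.
split=> [rk2|deg]; first by exists 1 => A; apply: rank2_solvable.
(* With [#|V|] field elements there are distinct evaluation points for all vertices. *)
by exists #|V| => F; apply: polynomial_solution.
Qed.
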